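(* Let $d\ge 2$ and let $\{y_I\}_{I\subseteq [d]}$ be a vector of real numbers. Then the following are equivalent. (i) The signed Minkowski sum $\sum_{I\subseteq[d]} y_I\Delta_I$ defines a generalized permutahedron in $\mathbb{R}^d$. (ii) For every $2$-element subset $E\subseteq[d]$ and every $T\subseteq[d]$ with $E\subseteq T$, \[\sum_{E\subseteq I\subseteq T} y_I \ \ge\ 0.\] In particular, the set of all coefficient vectors $\{y_I\}_{I\subseteq[d]}\in\mathbb{R}^{2^{[d]}}$ for which $\sum_I y_I\Delta_I$ defines a generalized permutahedron is a polyhedral cone, and the inequalities in (ii) are facet-defining for this cone.
   Context: $e_1,\dots,e_d$ denote the standard basis vectors of $\mathbb{R}^d$. For $\emptyset\ne I\subseteq[d]$, $\Delta_I=\mathrm{conv}\{e_i: i\in I\}$, and $\Delta_\emptyset=\{0\}$. The Minkowski sum of polytopes is $P+Q=\{p+q: p\in P, q\in Q\}$; $R$ is a Minkowski summand of $Q$ if $P+R=Q$ for some polytope $P$, and then $R$ is called the Minkowski difference $Q-P$. $R$ is a weak Minkowski summand of $Q$ if it is a Minkowski summand of $\lambda Q$ for some $\lambda>0$. The permutahedron is $\Pi_d=\mathrm{conv}\{(\sigma(1),\dots,\sigma(d)):\sigma\in S_d\}$, and a generalized permutahedron is a polytope in $\mathbb{R}^d$ that is a weak Minkowski summand of $\Pi_d$. A signed Minkowski sum $\sum_I y_I\Delta_I$ (formal real combination) is said to define a polytope if $P=\sum_{I: y_I<0}(-y_I)\Delta_I$ is a Minkowski summand of $Q=\sum_{I:y_I\ge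 0}y_I\Delta_I$; in that case it represents the Minkowski difference $Q-P$ (the polytope $R$ with $R+P=Q$). *)

(* Defs.v *)
From HB Require Import structures.
From mathcomp Require Import all_boot all_order all_algebra all_fingroup.
From mathcomp Require Import boolp classical_sets cardinality reals.

Set Implicit Arguments.
Unset Strict Implicit.
Unset Printing Implicit Defensive.

Import Order.TTheory GRing.Theory Num.Theory.

Local Open Scope classical_set_scope.
Local Open Scope ring_scope.

Section Polytopes.
Variables (R : realType) (V : lmodType R).
Implicit Types P Q S A : set V.

Definition conv A : set V :=
  [set x | exists (n : nat) (p : 'I_n -> V) (t : 'I_n -> R),
    [/\ forall i, A (p i), forall i, 0 <= t i, \sum_i t i = 1
      & x = \sum_i t i *: p i]].

Definition polytope P := exists2 A, finite_set A & P = conv A.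

Definition msum P Q : set V := [set p + q | p in P & q in Q].

Definition dilate (a : R) P : set V := [set a *: p | p in P].

Definition is_minkowski_difference Q P S := polytope S /\ msum S P = Q.

Definition minkowski_summand S Q := exists2 P, polytope P & msum P S = Q.

Definition weak_minkowski_summand S Q :=
  exists2 a : R, 0 < a & minkowski_summand S (dilate a Q).

End Polytopes.

(* The codomain is the regular module R^o so that this type carries the vector
   space structure of R^(2^[d]). *)
Notation coeffs R d := {ffun {set 'I_d} -> R^o}.

Section GeneralizedPermutahedra.
Variables (R : realType) (d : nat).

(* The index i : 'I_d stands for the element i + 1 of [d]. *)
Definition std_basis (i : 'I_d) : 'rV[R]_d := delta_mx 0 i.

Definition simplex (I : {set 'I_d}) : set 'rV[R]_d :=
  if I == finset.set0 then [set 0]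
  else conv [set std_basis i | i in [set` I]].

Definition permutahedron : set 'rV[R]_d :=
  conv [set (\row_i (s i).+1%:R) | s in [set: 'S_d]].

Definition generalized_permutahedron (G : set 'rV[R]_d) :=
  polytope G /\ weak_minkowski_summand G permutahedron.

Definition positive_part (y : coeffs R d) : set 'rV[R]_d :=
  \big[@msum R _/[set 0]]_(I : {set 'I_d} | 0 <= (y I : R))
    dilate (y I) (simplex I).

Definition negative_part (y : coeffs R d) : set 'rV[R]_d :=
  \big[@msum R _/[set 0]]_(I : {set 'I_d} | (y I : R) < 0)
    dilate (- y I) (simplex I).

Definition signed_sum_represents (y : coeffs R d) (G : set 'rV[R]_d) :=
  is_minkowski_difference (positive_part y) (negative_part y) G.

Definition defines_generalized_permutahedron (y : coeffs R d) :=
  exists2 G, signed_sum_represents y G & generalized_permutahedron G.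

Definition interval_sum (E T : {set 'I_d}) (y : coeffs R d) : R :=
  \sum_(I : {set 'I_d} | (E \subset I) && (I \subset T)) (y I : R).

Lemma interval_sum_is_scalar E T : scalar (interval_sum E T).
Proof.
move=> a x y; rewrite /interval_sum mulr_sumr -big_split.
by apply: eq_bigr => I _ /=; rewrite !ffunE.
Qed.

HB.instance Definition _ E T :=
  GRing.isLinear.Build R (coeffs R d) R *%R (interval_sum E T)
    (interval_sum_is_scalar E T).

End GeneralizedPermutahedra.

Section Cones.
Variables (R : realType) (V : vectType R).
Implicit Types (C A : set V).

Definition polyhedral_cone C :=
  exists (m : nat) (l : 'I_m -> {scalar V}), C = [set x | forall i, 0 <= l i x].

(* [U] is the smallest subspace containing all differences of points of [A],
   that is, the direction of the affine hull of [A]. *)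
Definition affine_dim A (k : nat) :=
  A !=set0 /\
  exists U : {vspace V},
    [/\ forall x y, A x -> A y -> x - y \in U,
        forall W : {vspace V},
          (forall x y, A x -> A y -> x - y \in W) -> (U <= W)%VS
      & \dim U = k].

Definition facet_defining C (l : {scalar V}) :=
  (forall x, C x -> 0 <= l x) /\
  exists k, affine_dim C k.+1 /\ affine_dim (C `&` [set x | l x = 0]) k.

End Cones.

(* Main.v *)
Require Import Defs.
From HB Require Import structures.
From mathcomp Require Import all_boot all_order all_algebra all_fingroup.
From mathcomp Require Import boolp classical_sets cardinality reals.
From mathcomp Require Import ring lra.
Import Order.TTheory GRing.Theory Num.Theory.
Local Open Scope classical_set_scope.
Local Open Scope ring_scope.

(** For a linear order [s] on [d], the greedy point of a set function [f] has as
    coordinates the successive increments of [f] along [s]. If [f] is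
    supermodular, the greedy point of [s] maximizes over all greedy points every
    functional that [s] sorts; since [s] does not depend on [f], separation
    shows that the base polytopes [B(f)], the hulls of the greedy points,
    satisfy [B(f) + B(g) = B(f + g)]. Now [Delta_I] is [B] of the indicator of
    [I \subset T], and the permutahedron is [B] of [|T| (|T| + 1) / 2], so the
    signed sum corresponds to [f_y(T) = \sum_(I \subset T) y_I], whose second
    differences are the sums in (ii). Conversely, if the signed sum represents
    [G], its support function is evaluated by the greedy points of [f_y], and
    its subadditivity at indicator vectors is the supermodularity of [f_y].
    For the facets, [|T|^2] has all second differences equal to 2, and raising
    it by 1 at [T :\ a] and at [T :\ b] makes only the second difference of
    [{a, b}], [T] vanish. *)

Set Implicit Arguments.
Unset Strict Implicit.
Unset Printing Implicit Defensive.

(** * Farkas' lemma for finitely many linear forms *)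

Lemma scalar_at0 (R : realFieldType) (V : lmodType R) (f : V -> R) :
  scalar f -> f 0 = 0.
Proof. by move=> fL; have := fL 1 0 0; rewrite scale1r addr0 mul1r; lra. Qed.

Lemma scalar_scale (R : realFieldType) (V : lmodType R) (f : V -> R) a x :
  scalar f -> f (a *: x) = a * f x.
Proof. by move=> fL; have := fL a x 0; rewrite addr0 scalar_at0// addr0. Qed.

(* Induction on the number of forms (Bartl): if dropping the form [alpha 0] breaks
   the implication at [x0], project everything along [x0] onto its kernel. *)
Lemma farkas (R : realFieldType) (V : lmodType R) (m : nat)
    (alpha : 'I_m -> V -> R) (gamma : V -> R) :
  (forall i, scalar (alpha i)) -> scalar gamma ->
  (forall x, (forall i, alpha i x <= 0) -> gamma x <= 0) ->
  exists2 lam : 'I_m -> R, forall i, 0 <= lam i &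
    forall x, gamma x = \sum_i lam i * alpha i x.
Proof.
elim: m alpha gamma => [|m IH] alpha gamma alphaL gammaL imp.
  exists (fun=> 0) => // x; rewrite big_ord0; apply/eqP; rewrite eq_le.
  rewrite imp => [|[]//]; have : gamma (- x) <= 0 by apply: imp => -[].
  by rewrite -scaleN1r scalar_scale// mulN1r oppr_le0.
pose beta i := alpha (lift ord0 i).
have [imp'|/existsNP[x0 /not_implyP[x0le /negP]]] :=
    pselect (forall x, (forall i, beta i x <= 0) -> gamma x <= 0).
  have [lam lam0 lamE] := IH beta gamma (fun i => alphaL _) gammaL imp'.
  exists (fun i => oapp lam 0 (unlift ord0 i)) => [i|x].
    by case: (unlift ord0 i) => /=.
  rewrite big_ord_recl unlift_none mul0r add0r lamE.
  by apply: eq_bigr => i _; rewrite liftK.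
rewrite -ltNge => x0gt.
have a0gt : 0 < alpha ord0 x0.
  rewrite ltNge; apply/negP => a0le; have := x0gt; rewrite ltNge imp // => i.
  by case: (unliftP ord0 i) => [j|] -> //; exact: x0le.
pose x1 := (alpha ord0 x0)^-1 *: x0.
have a0x1 : alpha ord0 x1 = 1 by rewrite scalar_scale// mulVf// gt_eqF.
have bx1 i : beta i x1 <= 0.
  by rewrite scalar_scale; [rewrite pmulr_rle0 ?invr_gt0 | exact: alphaL].
have gx1 : 0 < gamma x1 by rewrite scalar_scale// mulr_gt0// invr_gt0.
(* These are the forms [beta i] and [gamma] composed with the projection along [x1] onto the kernel
   of [alpha ord0]; [E] below records this. *)
pose beta' i x := beta i x - beta i x1 * alpha ord0 x.
pose gamma' x := gamma x - gamma x1 * alpha ord0 x.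
have E (f : V -> R) x : scalar f ->
    f (- alpha ord0 x *: x1 + x) = f x - f x1 * alpha ord0 x.
  by move=> ->; ring.
have [||x|lam lam0 lamE] := IH beta' gamma'.
- by move=> i a x y; rewrite /beta' /beta !alphaL; ring.
- by move=> a x y; rewrite /gamma' !alphaL !gammaL; ring.
- move=> le0; rewrite -[gamma' x]E//; apply: imp => i.
  case: (unliftP ord0 i) => [j|] ->; rewrite E//; first exact: le0.
  by rewrite a0x1 mul1r subrr.
(* Expanding the projected identity leaves [gamma x1 - mu] as the weight of [alpha ord0]; it is
   nonnegative since [gamma x1 > 0] and every [beta j x1 <= 0]. *)
pose mu := \sum_j lam j * beta j x1.
exists (fun i => oapp lam (gamma x1 - mu) (unlift ord0 i)).
  move=> i; case: (unlift ord0 i) => //=; rewrite subr_ge0.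
  apply: le_trans (ltW gx1); apply: sumr_le0 => j _.
  by rewrite mulr_ge0_le0.
move=> x; rewrite big_ord_recl unlift_none.
under eq_bigr do rewrite liftK.
rewrite /=.
have : gamma' x = \sum_i (lam i * beta i x - lam i * beta i x1 * alpha ord0 x).
  by rewrite lamE; apply: eq_bigr => i _; rewrite /beta' mulrBr mulrA.
by rewrite sumrB -mulr_suml mulrBl /gamma' /beta -/mu => H; lra.
Qed.

(** * Linear functionals and separation from a finite hull *)

Section Dot.
Variables (R : realType) (d : nat).
Implicit Types c x : 'rV[R]_d.

Definition dot c x : R := \sum_i c 0 i * x 0 i.

Lemma dotDr c x y : dot c (x + y) = dot c x + dot c y.
Proof. by rewrite -big_split; apply: eq_bigr => i _; rewrite mxE mulrDr. Qed.

Lemma dotDl c c' x : dot (c + c') x = dot c x + dot c' x.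
Proof. by rewrite -big_split; apply: eq_bigr => i _; rewrite mxE mulrDl. Qed.

Lemma dotZl a c x : dot (a *: c) x = a * dot c x.
Proof. by rewrite mulr_sumr; apply: eq_bigr => i _; rewrite mxE mulrA. Qed.

Lemma dotZr a c x : dot c (a *: x) = a * dot c x.
Proof. by rewrite mulr_sumr; apply: eq_bigr => i _; rewrite mxE mulrCA. Qed.

Lemma dot_sumr n c (p : 'I_n -> 'rV[R]_d) :
  dot c (\sum_i p i) = \sum_i dot c (p i).
Proof.
rewrite exchange_big; apply: eq_bigr => i _ /=.
by rewrite summxE mulr_sumr.
Qed.

Lemma dot_delta i x : dot (delta_mx 0 i) x = x 0 i.
Proof.
rewrite /dot (bigD1 i)//= mxE !eqxx mul1r big1 ?addr0// => j /negPf ji.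
by rewrite mxE ji andbF mul0r.
Qed.

Lemma dot_conv_le (A : set 'rV[R]_d) c x m :
  (forall p, A p -> dot c p <= m) -> conv A x -> dot c x <= m.
Proof.
move=> Am [n [p [t [Ap t0 t1 ->]]]]; rewrite dot_sumr -[m]mul1r -t1 mulr_suml.
by apply: ler_sum => i _; rewrite dotZr ler_wpM2l// Am.
Qed.

(* Farkas' lemma in the homogenized space [R^d * R]. *)
Lemma conv_separation (T : finType) (p : T -> 'rV[R]_d) x :
  (forall c, exists i, dot c x <= dot c (p i)) -> conv (range p) x.
Proof.
move=> sep.
pose ev q (v : 'rV[R]_d * R^o) : R := dot v.1 q + v.2.
have evL q : scalar (ev q).
  by move=> a u v; rewrite /ev /= dotDl dotZl mulrDr addrACA.
have [v le0|lam lam0 lamE] :=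
    @farkas R _ #|T| (fun i => ev (p (enum_val i))) (ev x) (fun i => evL _) (evL x).
  have [i xi] := sep v.1; have := le0 (enum_rank i); rewrite enum_rankK.
  by apply: le_trans; rewrite lerD2r.
exists #|T|, (p \o enum_val), lam; split=> //.
(* The Farkas identity at [(0, 1)] says that the weights sum to 1; at [(e_j, 0)] it gives the [j]-th
   coordinate of [x]. *)
- have := lamE (0, 1); rewrite /ev /=.
  have z q : dot 0 q = 0 by rewrite /dot big1// => i _; rewrite mxE mul0r.
  by rewrite z add0r => ->; apply: eq_bigr => i _; rewrite z add0r mulr1.
- apply/rowP => j; have := lamE (delta_mx 0 j, 0).
  rewrite /ev /= dot_delta addr0 => ->; rewrite summxE.
  by apply: eq_bigr => i _; rewrite dot_delta addr0 mxE.
Qed.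

End Dot.

(** * Convex hulls and dilation *)

Section ConvexHull.
Variables (R : realType) (V : lmodType R).
Implicit Types A : set V.

Lemma sub_conv A : A `<=` conv A.
Proof.
move=> x Ax; exists 1%N, (fun=> x), (fun=> 1); split=> //.
- by rewrite big_ord1.
- by rewrite big_ord1 scale1r.
Qed.

Lemma conv1 (x : V) : conv [set x] = [set x].
Proof.
apply/seteqP; split=> [_ [n [p [t [px t0 t1 ->]]]]|_ ->]; last exact: sub_conv.
by rewrite (eq_bigr (fun i => t i *: x)) ?[LHS]/= => [|i _];
  rewrite ?px// -scaler_suml t1 scale1r.
Qed.

Lemma dilate_conv a A : dilate a (conv A) = conv (dilate a A).
Proof.
apply/seteqP; split.
  move=> _ [_ [n [p [t [Ap t0 t1 ->]]]] <-].
  exists n, (fun i => a *: p i), t; split=> //; first by move=> i; exists (p i).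
  by rewrite scaler_sumr; apply: eq_bigr => i _; rewrite !scalerA mulrC.
move=> _ [n [p [t [Ap t0 t1 ->]]]].
have /choice[q qE] : forall i, exists q, A q /\ a *: q = p i.
  by move=> i; have [q Aq <-] := Ap i; exists q.
exists (\sum_i t i *: q i).
  by exists n, q, t; split=> // i; have [] := qE i.
rewrite scaler_sumr; apply: eq_bigr => i _; have [_ <-] := qE i.
by rewrite !scalerA mulrC.
Qed.

End ConvexHull.

(* Abel summation along the order [s]. *)
Lemma dot_ge0_of_partial_sums (R : realType) (d : nat)
    (c x : 'rV[R]_d) (s : 'S_d) :
  (forall i j, (s i <= s j)%N -> c 0 i <= c 0 j) ->
  (forall k, \sum_(i | (s i < k)%N) x 0 i <= 0) -> \sum_i x 0 i = 0 ->
  0 <= dot c x.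
Proof.
case: d c x s => [|n] c x s cs xs xsum; first by rewrite /dot big_ord0.
pose C k := c 0 (s^-1%g (inord k)); pose X k := x 0 (s^-1%g (inord k)).
have reix (F : 'I_n.+1 -> R) m : (m <= n.+1)%N ->
    \sum_(i | (s i < m)%N) F i = \sum_(k < m) F (s^-1%g (inord k)).
  move=> mn; rewrite (reindex_inj (@perm_inj _ s^-1%g)) /=.
  rewrite (big_ord_widen n.+1 (fun k => F (s^-1%g (inord k))))//.
  by apply: eq_big => i; rewrite ?permKV// => _; rewrite inord_val.
have le0 m : (m <= n.+1)%N -> \sum_(k < m) X k <= 0.
  by move=> mn; rewrite -(reix (x 0)).
(* The partial sums of [X] are nonpositive, so replacing [C m] by the larger [C m.+1] only lowers
   the left side. At [m = n] the left side is 0. *)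
have key m : (m <= n)%N ->
    C m * (\sum_(k < m.+1) X k) <= \sum_(k < m.+1) C k * X k.
  elim: m => [|m IH] mn; first by rewrite !big_ord1.
  rewrite big_ord_recr [X in _ <= X]big_ord_recr /= mulrDr lerD2r.
  apply: le_trans (IH (ltnW mn)).
  apply: ler_wnM2r; first by apply: le0; rewrite ltnW.
  by apply: cs; rewrite !permKV !inordK// ltnW.
have tot (F : 'I_n.+1 -> R) : \sum_i F i = \sum_(k < n.+1) F (s^-1%g (inord k)).
  by rewrite -(reix F)//; apply: eq_bigl => i; rewrite ltn_ord.
rewrite /dot tot; apply: le_trans (key n (leqnn _)).
by rewrite /X -(tot (x 0)) xsum mulr0.
Qed.

(** * Supermodular functions and their base polytopes *)

Section Supermodular.
Variables (R : realType) (d : nat).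
Implicit Types (f g : {set 'I_d} -> R) (s t : 'S_d) (c x : 'rV[R]_d).
Implicit Types (S T A B : {set 'I_d}).

(** The lattice inequality restricted to [T :\ a] and [T :\ b], that is, nonnegativity of the second
    differences. *)
Definition supermodular f := forall T a b, a \in T -> b \in T -> a != b ->
  f (T :\ a) + f (T :\ b) <= f T + f (T :\ a :\ b).

(** Elements of [B] outside [A] are removed one at a time, each removal being one second
    difference. *)
Lemma supermodular_increment f A B i : supermodular f ->
  i \in A -> A \subset B -> f A - f (A :\ i) <= f B - f (B :\ i).
Proof.
move=> fsm iA; have [n] := ubnP #|B|; elim: n B => // n IH B Bn AB.
have [<-//|AnB] := eqVneq A B.
have /properP[_ [k kB kA]] : A \proper B by rewrite finset.properEneq AnB.
have ki : k != i by apply: contraNneq kA => ->.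
have iB := fintype.subsetP AB i iA.
apply: le_trans (_ : f (B :\ k) - f (B :\ k :\ i) <= _).
  apply: IH; last by rewrite finset.subsetD1 AB.
  by move: Bn; rewrite (cardsD1 k) kB.
by have := fsm B k i kB iB ki; lra.
Qed.

Definition lowset s (k : nat) : {set 'I_d} := [set j | (s j < k)%N]%SET.

(* The vertex of the base polytope of [f] produced by the greedy algorithm
   processing the elements in the order [s]. *)
Definition greedy f s : 'rV[R]_d :=
  \row_i (f (lowset s (s i).+1) - f (lowset s (s i))).

Lemma greedyD f g s : greedy (fun T => f T + g T) s = greedy f s + greedy g s.
Proof. by apply/rowP => i; rewrite !mxE; ring. Qed.

Lemma greedyZ a f s : greedy (fun T => a * f T) s = a *: greedy f s.
Proof. by apply/rowP => i; rewrite !mxE; ring. Qed.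

Lemma lowsetD1 s i : lowset s (s i) = lowset s (s i).+1 :\ i.
Proof.
apply/setP => j; rewrite !inE ltnS; have [->|ji] := eqVneq j i.
  by rewrite ltnn.
by rewrite ltn_neqAle (inj_eq val_inj) (inj_eq perm_inj) ji.
Qed.

(** The sum telescopes along [s]: passing an element outside [T] leaves [T :&: lowset s k]
    unchanged. *)
Lemma sum_lowset f s T :
  \sum_(i in T) (f (T :&: lowset s (s i).+1) - f (T :&: lowset s (s i)))
  = f T - f finset.set0.
Proof.
pose F k := f (T :&: lowset s k).
transitivity (\sum_i (F (s i).+1 - F (s i))).
  rewrite big_mkcond; apply: eq_bigr => i _; case: ifPn => // iT.
  suff -> : F (s i).+1 = F (s i) by rewrite subrr.
  rewrite /F lowsetD1; congr f; apply/setP => j; rewrite !inE.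
  by have [->|//] := eqVneq j i; rewrite (negPf iT).
rewrite (reindex_inj (@perm_inj _ s^-1)) /=.
under eq_bigr do rewrite permKV.
rewrite -(big_mkord xpredT (fun k => F k.+1 - F k)) telescope_sumr// /F.
congr (f _ - f _); apply/setP => j; rewrite !inE ?ltn_ord ?andbT//.
by rewrite ltn0 andbF.
Qed.

Definition downclosed s T := forall i j, i \in T -> (s j <= s i)%N -> j \in T.

Lemma sum_greedy f s T : downclosed s T ->
  \sum_(i in T) greedy f s 0 i = f T - f finset.set0.
Proof.
move=> Tdown; rewrite -(sum_lowset f s); apply: eq_bigr => i iT; rewrite mxE.
have E k : (k <= (s i).+1)%N -> T :&: lowset s k = lowset s k.
  move=> ki; apply/finset.setIidPr/fintype.subsetP => j; rewrite inE => jk.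
  by apply: Tdown iT _; rewrite -ltnS (leq_trans jk).
by rewrite !E.
Qed.

(** Intersecting the low sets with [T] can only decrease the increments of a supermodular
    function. *)
Lemma sum_greedy_ge f s T : supermodular f ->
  f T - f finset.set0 <= \sum_(i in T) greedy f s 0 i.
Proof.
move=> fsm; rewrite -(sum_lowset f s); apply: ler_sum => i iT; rewrite mxE.
rewrite lowsetD1 finset.setIDA; apply: supermodular_increment => //.
  by rewrite !inE iT ltnSn.
exact: finset.subsetIr.
Qed.

(** Only strict inequalities are constrained: ties may be broken freely, so one order can sort
    several functionals. *)
Definition sorts s c := forall i j, c 0 i < c 0 j -> (s i < s j)%N.

Lemma exists_sorts c : exists s, sorts s c.
Proof.
pose r i j := c 0 i <= c 0 j.
have rtr : transitive r by move=> ? ? ?; apply: le_trans.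
have rtot : total r by move=> i j; apply: le_total.
pose l := sort r (enum 'I_d).
have lE i : i \in l by rewrite mem_sort mem_enum.
have sl : size l = d by rewrite size_sort size_enum_ord.
have il i : (index i l < d)%N by rewrite -[X in (_ < X)%N]sl index_mem.
have inj : injective (fun i => Ordinal (il i)).
  move=> i j [] /eqP; rewrite -(inj_eq (@succn_inj)) => /eqP[] e.
  by rewrite -(nth_index i (lE i)) e nth_index.
exists (perm inj) => i j cij; rewrite !permE /=.
rewrite ltnNge leq_eqVlt; apply/negP => /orP[/eqP e|ji].
  by move: cij; rewrite -(nth_index i (lE i)) -e nth_index// ltxx.
have := sorted_ltn_index rtr (sort_sorted rtot _) j i (lE j) (lE i) ji.
by rewrite /r leNgt cij.
Qed.

(** All greedy points have the same coordinate sum, and on each initial segment of [s] the greedy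
    point of [s] has the least sum; Abel summation concludes. *)
Lemma greedy_max f c s t : supermodular f -> sorts s c ->
  dot c (greedy f t) <= dot c (greedy f s).
Proof.
move=> fsm sc; rewrite -subr_ge0.
rewrite -mulN1r -dotZr -dotDr.
have low k : downclosed s (lowset s k).
  by move=> i j; rewrite !inE => ik ji; apply: leq_ltn_trans ik.
have sumB (P : pred 'I_d) : \sum_(i | P i) (greedy f s + -1 *: greedy f t) 0 i =
    \sum_(i | P i) greedy f s 0 i - \sum_(i | P i) greedy f t 0 i.
  by rewrite -sumrB; apply: eq_bigr => i _; rewrite !mxE mulN1r.
apply: (dot_ge0_of_partial_sums (s := s)).
- move=> i j; rewrite leqNgt; apply: contraR; rewrite -ltNge; exact: sc.
- move=> k; rewrite (eq_bigl (mem (lowset s k))) => [|i]; last by rewrite [RHS]inE.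
  by rewrite sumB subr_le0 (sum_greedy f (low k)) (sum_greedy_ge (f := f)).
- have E u : \sum_i greedy f u 0 i = f [set: 'I_d]%SET - f finset.set0.
    by rewrite -(@sum_greedy f u)//; apply: eq_bigl => i; rewrite inE.
  by rewrite sumB !E subrr.
Qed.

Definition basepoly f : set 'rV[R]_d := conv (range (greedy f)).

Lemma greedy_basepoly f s : basepoly f (greedy f s).
Proof. by apply: sub_conv; exists s. Qed.

Lemma basepoly_max f c s x : supermodular f -> sorts s c -> basepoly f x ->
  dot c x <= dot c (greedy f s).
Proof.
by move=> fsm sc; apply: dot_conv_le => _ [t _ <-]; apply: greedy_max.
Qed.

Lemma polytope_basepoly f : polytope (basepoly f).
Proof.
by exists (range (greedy f)) => //; apply: finite_image; exact: finite_finset.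
Qed.

(** One inclusion is separation, as an order sorting [c] is optimal for [f] and [g] at once. For the
    other, each greedy point of the sum splits, and the same convex weights serve both parts. *)
Lemma basepolyD f g : supermodular f -> supermodular g ->
  msum (basepoly f) (basepoly g) = basepoly (fun T => f T + g T).
Proof.
move=> fsm gsm; apply/seteqP; split.
  move=> _ [x fx [y gy <-]]; apply: conv_separation => c.
  have [s sc] := exists_sorts c; exists s.
  by rewrite greedyD !dotDr lerD// basepoly_max.
move=> _ [n [p [t [pE t0 t1 ->]]]].
have /choice[s sE] : forall i, exists s, greedy (fun T => f T + g T) s = p i.
  by move=> i; have [s _] := pE i; exists s.
exists (\sum_i t i *: greedy f (s i)); first by exists n, (greedy f \o s), t.
exists (\sum_i t i *: greedy g (s i)); first by exists n, (greedy g \o s), t.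
by rewrite -big_split; apply: eq_bigr => i _; rewrite -sE greedyD scalerDr.
Qed.

Lemma dilate_basepoly a f : dilate a (basepoly f) = basepoly (fun T => a * f T).
Proof.
rewrite /basepoly dilate_conv; congr conv; apply/seteqP; split.
  by move=> _ [_ [s _ <-] <-]; exists s; rewrite ?greedyZ.
by move=> _ [s _ <-]; exists (greedy f s); [exists s | rewrite greedyZ].
Qed.

Lemma supermodularD f g : supermodular f -> supermodular g ->
  supermodular (fun T => f T + g T).
Proof.
by move=> fsm gsm T a b aT bT ab; have := fsm T a b aT bT ab;
   have := gsm T a b aT bT ab; lra.
Qed.

Lemma supermodularZ a f : 0 <= a -> supermodular f ->
  supermodular (fun T => a * f T).
Proof. by move=> a0 fsm T i j iT jT ij; rewrite -!mulrDr ler_wpM2l// fsm. Qed.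

(** Supermodularity of the partial sum is carried along because [basepolyD] needs it at each
    step. *)
Lemma basepoly_sum (J : Type) (r : seq J) (P : pred J) (F : J -> {set 'I_d} -> R) :
  (forall j, P j -> supermodular (F j)) ->
  \big[@msum R _/[set 0]]_(j <- r | P j) basepoly (F j) =
    basepoly (fun T => \sum_(j <- r | P j) F j T)
  /\ supermodular (fun T => \sum_(j <- r | P j) F j T).
Proof.
move=> Fsm; elim: r => [|j r [IH1 IH2]].
  have -> : (fun T => \sum_(j <- [::] | P j) F j T) = fun=> 0.
    by apply/funext => T; rewrite big_nil.
  split=> //; rewrite big_nil /basepoly (_ : range _ = [set 0]) ?conv1//.
  have g0 s : greedy (fun=> 0) s = 0 by apply/rowP => i; rewrite !mxE subrr.
  apply/seteqP; split=> [_ [s _ <-]|_ ->]; first exact: g0.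
  by exists 1%g; rewrite ?g0.
have -> : (fun T => \sum_(j <- j :: r | P j) F j T) =
    if P j then (fun T => F j T + \sum_(j <- r | P j) F j T)
    else fun T => \sum_(j <- r | P j) F j T.
  by apply/funext => T; rewrite big_cons; case: ifP.
rewrite big_cons; case: ifP => // Pj.
have Fj := Fsm j Pj; rewrite IH1 (basepolyD Fj IH2); split=> //.
exact: supermodularD.
Qed.

End Supermodular.

(** * Signed Minkowski sums as differences of base polytopes *)

Section SignedSums.
Variables (R : realType) (d : nat).
Implicit Types (f g : {set 'I_d} -> R) (s t : 'S_d) (c x : 'rV[R]_d).
Implicit Types (I S T : {set 'I_d}).

Definition subset_ind I T : R := (I \subset T)%:R.

Lemma supermodular_subset_ind I : supermodular (subset_ind I).
Proof.
move=> T a b aT bT ab; rewrite /subset_ind !finset.subsetD1.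
by case: (I \subset T); case: (a \in I); case: (b \in I) => /=; lra.
Qed.

(** The indicator jumps from 0 to 1 exactly when the last element of [I] enters. *)
Lemma greedy_subset_ind I s i : i \in I -> (forall k, k \in I -> (s k <= s i)%N) ->
  greedy (subset_ind I) s = @std_basis R d i.
Proof.
move=> iI imax; have sub k : (I \subset lowset s k) = (s i < k)%N.
  apply/fintype.subsetP/idP => [/(_ i iI)|ik j jI]; first by rewrite inE.
  by rewrite inE; apply: leq_ltn_trans ik; apply: imax.
apply/rowP => j; rewrite !mxE /subset_ind !sub eqxx /= ltnS leq_eqVlt.
rewrite (inj_eq val_inj) (inj_eq perm_inj) eq_sym.
by have [->|] := eqVneq j i; rewrite ?ltnn ?subr0 //= subrr.
Qed.

Lemma simplex_basepoly I : @simplex R d I = basepoly (subset_ind I).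
Proof.
rewrite /simplex /basepoly; have [->|] := eqVneq I finset.set0.
  rewrite (_ : range _ = [set 0]) ?conv1//.
  have g0 s : greedy (subset_ind finset.set0) s = 0.
    by apply/rowP => i; rewrite !mxE /subset_ind !finset.sub0set subrr.
  apply/seteqP; split=> [_ [s _ <-]|_ ->]; first exact: g0.
  by exists 1%g; rewrite ?g0.
move=> /finset.set0Pn[i0 i0I]; congr conv; apply/seteqP; split.
  (* An order sorting [e_i] puts [i] last. *)
  move=> _ [i iI <-]; have [s si] := exists_sorts (delta_mx 0 i : 'rV[R]_d).
  exists s => //; apply: greedy_subset_ind => // k kI.
  have [->//|ki] := eqVneq k i; apply/ltnW/si.
  by rewrite !mxE !eqxx (negPf ki) ltr01.
move=> _ [s _ <-]; case: (arg_maxnP (fun i => val (s i)) i0I) => i iI imax.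
by exists i => //; rewrite (greedy_subset_ind iI).
Qed.

Lemma dilate_simplex a I :
  dilate a (@simplex R d I) = basepoly (fun T => a * subset_ind I T).
Proof. by rewrite simplex_basepoly dilate_basepoly. Qed.

(** The triangular number 1 + ... + |T|, whose increments along an order are 1, ..., d. *)
Definition card_tri T : R := 'C(#|T|.+1, 2)%:R.

Lemma card_lowset s k : (k <= d)%N -> #|lowset s k| = k.
Proof.
move=> kd; have -> : lowset s k = [set s^-1%g (widen_ord kd i) | i : 'I_k]%SET.
  apply/setP => j; rewrite inE; apply/idP/imsetP => [jk|[i _ ->]].
    exists (Ordinal jk) => //; rewrite (_ : widen_ord _ _ = s j) ?permK//.
    exact: val_inj.
  by rewrite permKV /=.
by rewrite card_imset ?card_ord// => i j /perm_inj /(congr1 val) /= /val_inj.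
Qed.

Lemma greedy_card_tri s : greedy card_tri s = \row_i (s i).+1%:R.
Proof.
apply/rowP => i; rewrite !mxE /card_tri !card_lowset// 1?ltnW//.
by rewrite binS bin1 natrD; ring.
Qed.

Lemma permutahedron_basepoly : @permutahedron R d = basepoly card_tri.
Proof.
rewrite /permutahedron /basepoly; congr conv.
by apply: eq_imagel => s _; rewrite greedy_card_tri.
Qed.

Lemma card_tri_second_difference T a b : a \in T -> b \in T -> a != b ->
  card_tri T + card_tri (T :\ a :\ b) = 1 + (card_tri (T :\ a) + card_tri (T :\ b)).
Proof.
move=> aT bT ab; rewrite /card_tri.
set n := #|T :\ a :\ b|.
have Ta : #|T :\ a| = n.+1 by rewrite (cardsD1 b) !inE eq_sym ab bT.
have Tb : #|T :\ b| = n.+1.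
  by rewrite (cardsD1 a) !inE ab aT /n finset.setDDl finset.setUC -finset.setDDl.
have -> : #|T| = n.+2 by rewrite (cardsD1 a) aT Ta.
by rewrite Ta Tb (binS n.+2) (binS n.+1) !bin1 !natrD !mulrSr; ring.
Qed.

Definition down_sum (y : coeffs R d) T : R :=
  \sum_(I : {set 'I_d}) (y I : R) * subset_ind I T.

Lemma down_sum_second_difference (y : coeffs R d) T a b :
  a \in T -> b \in T -> a != b ->
  down_sum y T + down_sum y (T :\ a :\ b) =
  down_sum y (T :\ a) + down_sum y (T :\ b) + interval_sum [set a; b]%SET T y.
Proof.
move=> aT bT ab; rewrite /down_sum /interval_sum [X in _ + _ + X]big_mkcond.
rewrite -!big_split; apply: eq_bigr => I _ /=; rewrite /subset_ind.
rewrite finset.subUset !finset.sub1set !finset.subsetD1.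
by case: (I \subset T); case: (a \in I); case: (b \in I) => /=; ring.
Qed.

Lemma supermodular_down_sum (y : coeffs R d) :
  supermodular (down_sum y) <->
  forall E T : {set 'I_d}, #|E| = 2%N -> E \subset T -> 0 <= interval_sum E T y.
Proof.
split=> [ysm E T /eqP/cards2P[a [b [ab ->]]]|yge T a b aT bT ab].
  rewrite finset.subUset !finset.sub1set => /andP[aT bT].
  have := ysm T a b aT bT ab.
  by rewrite down_sum_second_difference// lerDl.
rewrite down_sum_second_difference// lerDl yge//; first by rewrite cards2 ab.
by rewrite finset.subUset !finset.sub1set aT.
Qed.

Definition positive_sum (y : coeffs R d) T : R :=
  \sum_(I : {set 'I_d} | 0 <= (y I : R)) (y I : R) * subset_ind I T.

Definition negative_sum (y : coeffs R d) T : R :=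
  \sum_(I : {set 'I_d} | (y I : R) < 0) - (y I : R) * subset_ind I T.

Lemma positive_part_basepoly (y : coeffs R d) :
  positive_part y = basepoly (positive_sum y) /\ supermodular (positive_sum y).
Proof.
rewrite /positive_part; under eq_bigr do rewrite dilate_simplex.
apply: basepoly_sum => I yI; apply: supermodularZ yI _.
exact: supermodular_subset_ind.
Qed.

Lemma negative_part_basepoly (y : coeffs R d) :
  negative_part y = basepoly (negative_sum y) /\ supermodular (negative_sum y).
Proof.
rewrite /negative_part; under eq_bigr do rewrite dilate_simplex.
apply: basepoly_sum => I yI; apply: supermodularZ; first by rewrite oppr_ge0 ltW.
exact: supermodular_subset_ind.
Qed.

Lemma positive_sumE (y : coeffs R d) :
  positive_sum y = fun T => down_sum y T + negative_sum y T.
Proof.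
apply/funext => T; rewrite /positive_sum /negative_sum /down_sum.
rewrite [LHS]big_mkcond [X in _ + X]big_mkcond -big_split; apply: eq_bigr => I _ /=.
by rewrite /subset_ind; case: leP; case: (I \subset T) => /= _; ring.
Qed.

(** The second differences of [card_tri] all equal 1, so a large multiple of it minus [f] is
    supermodular and gives the complementary summand. *)
Lemma basepoly_generalized_permutahedron f :
  supermodular f -> generalized_permutahedron (basepoly f).
Proof.
move=> fsm; split; first exact: polytope_basepoly.
(* Each of the four values of [f] in a second difference is then at most [a / 4] in absolute value;
   the 1 makes [a] positive. *)
pose a := 1 + \sum_T `|f T| *+ 4.
have a0 : 0 < a by rewrite ltr_pwDl// sumr_ge0// => T _; rewrite mulrn_wge0.
have fa U : `|f U| *+ 4 <= a.
  rewrite /a (bigD1 U)//= addrCA lerDl addr_ge0// sumr_ge0// => V _.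
  by rewrite mulrn_wge0.
clearbody a.
exists a => //; exists (basepoly (fun T => a * card_tri T - f T)).
  exact: polytope_basepoly.
have gsm : supermodular (fun T => a * card_tri T - f T).
  move=> T i j iT jT ij; have ij' := card_tri_second_difference iT jT ij.
  have hi U : f U <= a / 4.
    by rewrite ler_pdivlMr// mulr_natr (le_trans _ (fa U))// lerMn2r ler_norm.
  have lo U : - f U <= a / 4.
    rewrite ler_pdivlMr// mulr_natr (le_trans _ (fa U))// lerMn2r.
    by rewrite -normrN ler_norm.
  have := congr1 ( *%R a) ij'; rewrite !mulrDr mulr1.
  move: (hi T) (hi (T :\ i :\ j)) (lo (T :\ i)) (lo (T :\ j)).
  move: (f T) (f (T :\ i)) (f (T :\ j)) (f (T :\ i :\ j)) => f1 f2 f3 f4.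
  move: (card_tri T) (card_tri (T :\ i)) (card_tri (T :\ j)).
  by move: (card_tri _) => c1 c2 c3 c4; lra.
rewrite basepolyD// permutahedron_basepoly dilate_basepoly.
by congr basepoly; apply/funext => T; rewrite subrK.
Qed.

(* Since [G + P = Q], the support function of [G] is the difference of those of
   [Q] and [P], which are both evaluated by the greedy algorithm. *)
Lemma signed_sum_max (y : coeffs R d) (G : set 'rV[R]_d) c s :
  signed_sum_represents y G -> sorts s c ->
  (forall x, G x -> dot c x <= dot c (greedy (down_sum y) s)) /\
  (exists2 x, G x & dot c x = dot c (greedy (down_sum y) s)).
Proof.
move=> [_]; have [-> psm] := positive_part_basepoly y.
have [-> nsm] := negative_part_basepoly y => GPQ sc.
have gE : dot c (greedy (positive_sum y) s) =
    dot c (greedy (down_sum y) s) + dot c (greedy (negative_sum y) s).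
  by rewrite positive_sumE greedyD dotDr.
have le x : G x -> dot c x <= dot c (greedy (down_sum y) s).
  move=> Gx; rewrite -(lerD2r (dot c (greedy (negative_sum y) s))) -gE -dotDr.
  apply: basepoly_max => //; rewrite -GPQ.
  exists x => //; exists (greedy (negative_sum y) s) => //.
  exact: greedy_basepoly.
split=> //; have := greedy_basepoly (positive_sum y) s.
rewrite -GPQ => -[x Gx [p Pp xp]]; exists x => //; apply/eqP.
rewrite eq_le le//=; move: gE; rewrite -xp dotDr => gE.
by have := basepoly_max nsm sc Pp; lra.
Qed.

(** The sign makes sorting put [T] first, so that [T] is an initial segment and the greedy point
    evaluates [f] at [T]. *)
Definition neg_ind T : 'rV[R]_d := \row_i - (i \in T)%:R.

Lemma dot_neg_ind_greedy f s T : sorts s (neg_ind T) ->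
  dot (neg_ind T) (greedy f s) = f finset.set0 - f T.
Proof.
move=> sT; rewrite -[RHS]opprB -(@sum_greedy _ _ _ s) => [|i j iT].
  rewrite -sumrN [RHS]big_mkcond; apply: eq_bigr => i _; rewrite mxE.
  by case: (i \in T) => /=; ring.
apply: contraLR => jT; rewrite -ltnNge; apply: sT.
by rewrite !mxE iT (negPf jT) oppr0 ltrN10.
Qed.

Lemma supermodular_of_signed_sum (y : coeffs R d) G :
  signed_sum_represents y G -> supermodular (down_sum y).
Proof.
move=> yG T a b aT bT ab; pose g := down_sum y.
have maxG U x : G x -> dot (neg_ind U) x <= g finset.set0 - g U.
  have [s sU] := exists_sorts (neg_ind U).
  by rewrite -(dot_neg_ind_greedy g sU); apply: (signed_sum_max yG sU).1.
(* [T] and [T :\ a :\ b] form a chain, so one order sorts both indicators. *)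
pose c := neg_ind (T :\ a) + neg_ind (T :\ b).
have cE : c = neg_ind T + neg_ind (T :\ a :\ b).
  apply/rowP => i; rewrite !mxE !inE.
  have [->|ib] := eqVneq i b; last by case: eqVneq => _ /=; ring.
  by rewrite eq_sym (negPf ab) /=; ring.
have [s sc] := exists_sorts c.
have sT : sorts s (neg_ind T).
  move=> i j; rewrite !mxE ltrN2 ltr_nat => ij; apply: sc; move: ij.
  rewrite cE !mxE !inE.
  case: (i \in T) => //; case: (j \in T) => // _; rewrite !andbF !andbT /=.
  by case: (_ && _) => /=; lra.
have sU : sorts s (neg_ind (T :\ a :\ b)).
  move=> i j; rewrite !mxE ltrN2 ltr_nat => ij; apply: sc; move: ij.
  rewrite cE !mxE !inE.
  case: (i \in T); case: (j \in T); rewrite ?andbF ?andbT //=.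
    by case: (_ && _); case: (_ && _) => //=; lra.
  by case: (_ && _) => //=; lra.
(* At a maximizer [x] of [c] on [G], the value is given by [g] at [T] and [T :\ a :\ b], while
   [maxG] bounds it through [T :\ a] and [T :\ b]. *)
have [x Gx cx] := (signed_sum_max yG sc).2.
move: cx; rewrite {2}cE !dotDl !dot_neg_ind_greedy//.
by have := maxG (T :\ a) x Gx; have := maxG (T :\ b) x Gx; rewrite /g; lra.
Qed.

Lemma defines_generalized_permutahedronP (y : coeffs R d) :
  defines_generalized_permutahedron y <->
  forall E T : {set 'I_d}, #|E| = 2%N -> E \subset T -> 0 <= interval_sum E T y.
Proof.
rewrite -supermodular_down_sum; split=> [[G yG _]|ysm].
  exact: supermodular_of_signed_sum yG.
exists (basepoly (down_sum y)); last exact: basepoly_generalized_permutahedron.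
split; first exact: polytope_basepoly.
have [-> _] := positive_part_basepoly y; have [-> nsm] := negative_part_basepoly y.
by rewrite basepolyD// positive_sumE.
Qed.

End SignedSums.

(** * Facets of a cone cut out by finitely many forms *)

Section Facets.
Variables (R : realType) (V : vectType R).

Lemma scalar_le_perturb (J : finType) (l : J -> {scalar V}) x v :
  (forall j, 0 < l j x \/ (l j x = 0 /\ l j v = 0)) ->
  exists2 e : R, 0 < e & forall j, 0 <= l j (x + e *: v).
Proof.
(* [M] bounds every ratio, so a step of [1 / M] is safe; forms vanishing at [x] add only 0, by the
   convention for division by 0. *)
move=> lx; pose M := 1 + \sum_j `|l j v| / `|l j x|.
have M0 : 0 < M by rewrite ltr_pwDl// sumr_ge0// => j _; rewrite divr_ge0.
exists M^-1 => [|j]; first by rewrite invr_gt0.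
rewrite linearD linearZ /=; case: (lx j) => [lxj|[-> ->]]; last first.
  by rewrite mulr0 addr0.
have : `|l j v| / l j x <= M.
  rewrite /M (bigD1 j)//= (gtr0_norm lxj) addrCA lerDl addr_ge0// sumr_ge0// => i _.
  by rewrite divr_ge0.
rewrite ler_pdivrMr// => lv; rewrite -(pmulr_rge0 _ M0) mulrDr mulrA.
rewrite mulfV ?gt_eqF// mul1r.
by have := ler_norm (- l j v); rewrite normrN; lra.
Qed.

(** The codomain [R^o] is a vector space of dimension 1, so [linfun] applies and the kernel becomes
    a subspace with a dimension. *)
Definition scalar_fun (l : {scalar V}) : V -> R^o := l.
Lemma scalar_fun_is_linear l : linear (scalar_fun l).
Proof. by move=> a x y; rewrite /scalar_fun linearP. Qed.
HB.instance Definition _ l := GRing.isLinear.Build R V R^o *:%R (scalar_fun l)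
  (scalar_fun_is_linear l).

Definition scalar_ker (l : {scalar V}) : {vspace V} := lker (linfun (scalar_fun l)).

Lemma mem_scalar_ker l x : (x \in scalar_ker l) = (l x == 0).
Proof. by rewrite memv_ker lfunE. Qed.

Lemma dim_scalar_ker (l : {scalar V}) x :
  l x != 0 -> \dim {:V} = (\dim (scalar_ker l)).+1.
Proof.
move=> lx; rewrite -(limg_ker_dim (linfun (scalar_fun l)) fullv) capfv addnC -add1n.
congr (_ + _)%N; apply/eqP; rewrite eqn_leq; apply/andP; split.
  by rewrite (leq_trans (dimvS (subvf _)))// dimvf /dim /=.
rewrite lt0n dimv_eq0; apply: contraNneq lx => im0.
have := memv_img (linfun (scalar_fun l)) (memvf x).
by rewrite im0 memv0 lfunE.
Qed.

(** Around [x0] every direction is feasible, so the cone has full dimension; around [x1] every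
    direction in the kernel of [l j0] stays in the face, which thus has codimension 1. *)
Lemma facet_defining_of_strict (J : finType) (l : J -> {scalar V}) j0 x0 x1 :
  (forall j, 0 < l j x0) -> l j0 x1 = 0 -> (forall j, j != j0 -> 0 < l j x1) ->
  facet_defining [set x | forall j, 0 <= l j x] (l j0).
Proof.
move=> l0 lj0 l1; split=> [x Cx|]; first exact: Cx.
exists (\dim (scalar_ker (l j0))); split.
  split; first by exists x0 => j; apply/ltW.
  exists fullv; split=> [x y _ _|W WC|]; first exact: memvf.
    apply/subvP => v _; have [j|e e0 ex] := @scalar_le_perturb J l x0 v.
      by left.
    suff : e *: v \in W by rewrite rpredZeq gt_eqF.
    have := WC (x0 + e *: v) x0 ex (fun j => ltW (l0 j)).
    by rewrite addrAC subrr add0r.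
  by apply: (@dim_scalar_ker _ x0); rewrite gt_eqF.
have Fx1 : ([set x | forall j, 0 <= l j x] `&` [set x | l j0 x = 0]) x1.
  split=> // j; have [->|/l1/ltW//] := eqVneq j j0; by rewrite lj0.
split; first by exists x1.
exists (scalar_ker (l j0)); split=> // [x y [_ lx] [_ ly]|W WC].
  by rewrite mem_scalar_ker linearB /= lx ly subrr.
apply/subvP => v; rewrite mem_scalar_ker => /eqP lv.
have [j|e e0 ex] := @scalar_le_perturb J l x1 v.
  by have [->|/l1] := eqVneq j j0; [right | left].
have := WC (x1 + e *: v) x1 (conj ex _) Fx1; rewrite addrAC subrr add0r rpredZeq.
rewrite gt_eqF//= => -> //.
by rewrite /= linearD linearZ /= lj0 lv mulr0 addr0.
Qed.

End Facets.

(** * Strict points for the interval inequalities *)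

Section IntervalFacets.
Variables (R : realType) (d : nat).
Implicit Types (E T A : {set 'I_d}).

(** Its set function is the binomial coefficient of |T| over 2; doubled, this is |T|^2 up to the
    modular term |T|. *)
Definition pair_coeffs : coeffs R d := [ffun I : {set 'I_d} => (#|I| == 2%N)%:R].

Lemma interval_sum_pair E T : #|E| = 2%N -> E \subset T ->
  interval_sum E T pair_coeffs = 1.
Proof.
move=> E2 ET; rewrite /interval_sum (bigD1 E)/=; last by rewrite subxx ET.
rewrite ffunE E2 eqxx big1 ?addr0// => I /andP[/andP[EI _] IE].
rewrite ffunE; case: eqP => // I2; case/negP: IE.
by rewrite eq_sym eqEcard EI I2 E2.
Qed.

(* The Moebius inverse of the indicator function of the single subset [A]. *)
Definition moebius_coeffs A : coeffs R d :=
  [ffun I : {set 'I_d} => (A \subset I)%:R * (-1) ^+ #|I :\: A|].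

(** The interval sum is an iterated difference in the directions of [E], evaluating the set function
    between [T :\: E] and [T]; it meets [A] only if [T = E :|: A]. *)
Lemma interval_sum_moebius E T A : E \subset T ->
  interval_sum E T (moebius_coeffs A) = (T == E :|: A)%:R * (-1) ^+ #|E :\: A|.
Proof.
move=> ET; rewrite /interval_sum.
have [->|TEA] := eqVneq T (E :|: A).
  rewrite (bigD1 (E :|: A))/=; last by rewrite finset.subsetUl subxx.
  rewrite ffunE finset.subsetUr finset.setDUl finset.setDv finset.setU0.
  rewrite big1 ?addr0// => I /andP[/andP[EI IEA]].
  rewrite finset.eqEsubset IEA finset.subUset EI ffunE /= => /negPf ->.
  by rewrite mul0r.
rewrite mul0r; have [AT|nAT] := boolP (A \subset T); last first.
  rewrite big1// => I /andP[_ IT]; rewrite ffunE.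
  case: (boolP (A \subset I)) => [AI|]; last by rewrite mul0r.
  by case/negP: nAT; apply: fintype.subset_trans IT.
have /fintype.subsetPn[k kT kEA] : ~~ (T \subset E :|: A).
  apply: contra TEA => TEA; by rewrite finset.eqEsubset TEA finset.subUset ET.
move: kEA; rewrite inE negb_or => /andP[kE kA].
(* The terms of [I] and of its symmetric difference with [{k}] cancel. *)
pose P (I : {set 'I_d}) := (E \subset I) && (I \subset T).
have kP (I : {set 'I_d}) : k \notin I -> P (k |: I) = P I.
  move=> kI; rewrite /P finset.subUset finset.sub1set kT /=; congr (_ && _).
  apply/idP/idP => [EkI|EI].
    by rewrite -(finset.setU1K kI) finset.subsetD1 EkI.
  exact: fintype.subset_trans (finset.subsetUr _ _).
rewrite (bigID (fun I : {set 'I_d} => k \in I))/=; apply/eqP.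
rewrite addr_eq0 -sumrN; apply/eqP.
rewrite (reindex_onto (fun I => k |: I) (fun I => I :\ k)) /=; last first.
  by move=> I /andP[_ kI]; rewrite finset.setD1K.
apply: eq_big => [I|I /andP[_ /eqP kI]].
  rewrite setU11 andbT; have [kI|kI] := boolP (k \in I).
    rewrite andbF; apply/negP => /andP[_ /eqP/setP/(_ k)].
    by rewrite !inE eqxx kI.
  by rewrite finset.setU1K// eqxx !andbT; apply: kP.
have kI' : k \notin I by rewrite -kI !inE eqxx.
rewrite !ffunE (_ : (A \subset k |: I) = (A \subset I)); last first.
  by rewrite -[in RHS]kI finset.subsetD1 kA andbT.
rewrite finset.setDUl (_ : [set k]%SET :\: A = [set k]%SET); last first.
  by apply/finset.setDidPl; rewrite disjoints1.
by rewrite cardsU1 !inE (negPf kI') andbF add1n exprS; ring.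
Qed.

Definition facet_point T (a b : 'I_d) : coeffs R d :=
  2 *: pair_coeffs + moebius_coeffs (T :\ a) + moebius_coeffs (T :\ b).

Lemma interval_sum_moebius_ge E T A : E \subset T ->
  -1 <= interval_sum E T (moebius_coeffs A).
Proof.
move=> ET; rewrite interval_sum_moebius//.
by rewrite -signr_odd; case: (T == _); case: (odd _); rewrite /= ?expr1 ?expr0; lra.
Qed.

Lemma interval_sum_moebius_D1 E T a : E \subset T -> a \in E ->
  interval_sum E T (moebius_coeffs (T :\ a)) = -1.
Proof.
move=> ET aE; rewrite interval_sum_moebius//.
have -> : E :\: (T :\ a) = [set a]%SET.
  apply/setP => i; rewrite !inE negb_and negbK.
  have [->|ia] := eqVneq i a; first by rewrite aE.
  by case: (boolP (i \in E)) => [/(fintype.subsetP ET) ->|]; rewrite ?andbF.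
rewrite cards1 expr1 (_ : T == _) ?mul1r//; apply/eqP/setP => i; rewrite !inE.
have [->|ia] := eqVneq i a; first by rewrite aE (fintype.subsetP ET).
by case: (boolP (i \in E)) => [/(fintype.subsetP ET) ->|].
Qed.

Lemma interval_sum_moebius_lt0 E T A : E \subset T -> #|E| = 2%N ->
  interval_sum E T (moebius_coeffs A) < 0 -> T = E :|: A /\ #|E :\: A| = 1%N.
Proof.
move=> ET E2; rewrite interval_sum_moebius//.
have [->|_] := eqVneq T; last by rewrite mul0r ltxx.
have : (#|E :\: A| <= 2)%N by rewrite -E2 subset_leq_card// finset.subsetDl.
by case: #|_| => [|[|[|]]]//= _; rewrite mul1r ?expr0 ?sqrrN ?expr1n ltr10.
Qed.

(** Each Moebius vector lowers the value 2 by at most 1, so a nonpositive sum makes both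
    contributions negative; this determines [T'] and then [E']. *)
Lemma interval_sum_facet_point E T E' T' a b :
  #|E| = 2%N -> E \subset T -> E = [set a; b]%SET ->
  #|E'| = 2%N -> E' \subset T' -> (E', T') != (E, T) ->
  0 < interval_sum E' T' (facet_point T a b).
Proof.
move=> E2 ET Eab E2' ET' neq; rewrite /facet_point !linearD linearZ /=.
rewrite interval_sum_pair// mulr1.
have ge A := interval_sum_moebius_ge A ET'.
have lt A := @interval_sum_moebius_lt0 _ _ A ET' E2'.
rewrite ltNge; apply: contra neq => le0.
have [|Ta ca] := lt (T :\ a); first by have := ge (T :\ b); lra.
have [|Tb _] := lt (T :\ b); first by have := ge (T :\ a); lra.
have aT : a \in T by apply: (fintype.subsetP ET); rewrite Eab !inE eqxx.
have bT : b \in T by apply: (fintype.subsetP ET); rewrite Eab !inE eqxx orbT.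
have ab : a != b.
  by apply: contra_eqN E2 => /eqP ab; rewrite Eab ab finset.setUid cards1.
(* [T'] contains [T] because [a] and [b] differ, and it has just one element more than [T :\ a]. *)
have TT : T' = T.
  apply/esym/eqP; rewrite eqEcard; apply/andP; split.
    apply/fintype.subsetP => i iT; have [->|ia] := eqVneq i a.
      by rewrite Tb !inE ab aT orbT.
    by rewrite Ta !inE ia iT orbT.
  rewrite Ta -(cardsID (T :\ a)) finset.setDUl finset.setDv finset.setU0 ca.
  by rewrite finset.setIC finset.setKU (cardsD1 a T) aT addnC.
have aE : a \in E' by move: aT; rewrite -{1}TT Ta !inE eqxx orbF.
have bE : b \in E' by move: bT; rewrite -{1}TT Tb !inE eqxx orbF.
rewrite TT xpair_eqE eqxx andbT eq_sym eqEcard E2 E2' leqnn andbT Eab.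
by rewrite finset.subUset !finset.sub1set aE.
Qed.

(** A single finite index type for all the inequalities in (ii). *)
Definition edge_interval :=
  {p : {set 'I_d} * {set 'I_d} | (#|p.1| == 2%N) && (p.1 \subset p.2)}.

Definition edge_interval_sum (j : edge_interval) : {scalar coeffs R d} :=
  interval_sum (val j).1 (val j).2.

Lemma generalized_permutahedron_coneE :
  [set y : coeffs R d | defines_generalized_permutahedron y] =
  [set y | forall j, 0 <= edge_interval_sum j y].
Proof.
apply/seteqP; split=> y /=.
  move=> /defines_generalized_permutahedronP y0 j.
  by case/andP: (valP j) => /eqP; apply: y0.
move=> y0; apply/defines_generalized_permutahedronP => E T /eqP E2 ET.
by have := y0 (Sub (E, T) (introT andP (conj E2 ET))).
Qed.

Lemma polyhedral_cone_generalized_permutahedron :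
  polyhedral_cone [set y : coeffs R d | defines_generalized_permutahedron y].
Proof.
exists #|{: edge_interval}|, (fun i => edge_interval_sum (enum_val i)).
rewrite generalized_permutahedron_coneE; apply/seteqP; split=> y /= y0 j //.
by have := y0 (enum_rank j); rewrite enum_rankK.
Qed.

Lemma facet_defining_interval_sum E T : #|E| = 2%N -> E \subset T ->
  facet_defining [set y : coeffs R d | defines_generalized_permutahedron y]
    (interval_sum E T).
Proof.
move=> E2 ET; rewrite generalized_permutahedron_coneE.
have ETP : (#|(E, T).1| == 2%N) && ((E, T).1 \subset (E, T).2) by rewrite E2 eqxx.
pose j0 : edge_interval := Sub (E, T) ETP.
have /eqP/cards2P[a [b [ab Eab]]] := E2.
have jP (j : edge_interval) := valP j.
apply: (@facet_defining_of_strict _ _ _ edge_interval_sum j0 pair_coeffs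
  (facet_point T a b)).
- move=> j; case/andP: (jP j) => /eqP j2 jj.
  by rewrite [edge_interval_sum j _]interval_sum_pair.
- rewrite [LHS](_ : _ = interval_sum E T (facet_point T a b))//.
  rewrite /facet_point !linearD linearZ /= interval_sum_pair//.
  by rewrite !interval_sum_moebius_D1// ?Eab ?inE ?eqxx ?orbT//; ring.
- move=> j jj0; case/andP: (jP j) => /eqP j2 jj.
  apply: (interval_sum_facet_point E2 ET Eab j2 jj).
  apply: contra jj0 => /eqP jE; apply/eqP/val_inj.
  by rewrite /= -jE -surjective_pairing.
Qed.

End IntervalFacets.

Theorem theorem2p4 (R : realType) (d : nat) (hd : (2 <= d)%N) :
  (forall y : coeffs R d,
     defines_generalized_permutahedron y <->
     (forall E T : {set 'I_d}, #|E| = 2%N -> E \subset T ->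
        0 <= \sum_(I : {set 'I_d} | (E \subset I) && (I \subset T)) (y I : R)))
  /\ polyhedral_cone [set y : coeffs R d | defines_generalized_permutahedron y]
  /\ (forall E T : {set 'I_d}, #|E| = 2%N -> E \subset T ->
        facet_defining
          [set y : coeffs R d | defines_generalized_permutahedron y]
          (interval_sum E T)).
Proof.
split; first exact: defines_generalized_permutahedronP.
split; first exact: polyhedral_cone_generalized_permutahedron.
exact: facet_defining_interval_sum.
Qed.
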